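(* Let $G$ be a finite abelian group, $\varepsilon\ge0$, and let $\Phi\subset G$ satisfy $\max_{\gamma\in\hat G,\gamma\ne1}\big|\sum_{x\in\Phi}\gamma(x)\big|\le\varepsilon|\Phi|$. Then for every $q>2$ there is a constant $C_q$ depending only on $q$ such that for every $f:G\to\mathbb{C}$ with $\{x:f(x)\neq0\}\subset\Phi$, $$\mathbb{E}_{\gamma\in\hat G}|\hat f(\gamma)|^q\le C_q\,\|f\|_2^q\,|\Phi|^{q/2}\Big(|G|^{-1}+\varepsilon^{\frac q2-1}|\Phi|^{-1}\Big).$$ In particular, if moreover $|f(x)|\le1$ for all $x$ and $\varepsilon\le(|\Phi|/|G|)^{2/(q-2)}$, then $\mathbb{E}_{\gamma\in\hat G}|\hat f(\gamma)|^q\le C_q|\Phi|^q|G|^{-1}$.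
   Context: $\hat G$ is the group of characters of $G$ (homomorphisms to the unit circle), $1$ the trivial character. The Fourier transform is $\hat f(\gamma):=\sum_{x\in G}f(x)\overline{\gamma(x)}$, $\mathbb{E}_{\gamma\in\hat G}$ denotes the average over $\hat G$, and $\|f\|_2:=(\sum_{x\in G}|f(x)|^2)^{1/2}$. *)

(* Defs.v *)
From HB Require Import structures.
From mathcomp Require Import all_boot all_order all_algebra.
From mathcomp Require Import complex.
From mathcomp Require Import all_classical all_reals all_analysis.

Set Implicit Arguments.
Unset Strict Implicit.
Unset Printing Implicit Defensive.

Import Order.TTheory GRing.Theory Num.Theory.
Local Open Scope ring_scope.

(* The norm `|z| of R[i] lies in R[i]; [normc z : R] is the same modulus, taken
   in R, where real powers are available. *)
Notation normc := ComplexField.Normc.normc.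

Section Characters.
Variables (R : realType) (G : finZmodType).

Definition is_character (g : {ffun G -> R[i]}) : bool :=
  [forall x, forall y, g (x + y) == g x * g y]
  && [forall x, normc (g x) == 1].

Record character : predArgType :=
  Character { char_ffun :> {ffun G -> R[i]}; _ : is_character char_ffun }.

HB.instance Definition _ := [isSub for char_ffun].
HB.instance Definition _ := [Choice of character by <:].

Lemma characterD (g : character) x y : g (x + y) = g x * g y.
Proof. by have /andP[/forallP/(_ x)/forallP/(_ y)/eqP] := valP g. Qed.

Lemma normc_character (g : character) x : normc (g x) = 1.
Proof. by have /andP[_ /forallP/(_ x)/eqP] := valP g. Qed.

Lemma character_neq0 (g : character) x : g x != 0.
Proof.
apply/eqP => gx0; have := normc_character g x.
by rewrite gx0 ComplexField.Normc.normc0 => /esym/eqP; rewrite oner_eq0.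
Qed.

Lemma character_unity (g : character) x : g x ^+ #|G| = 1.
Proof.
have nz : \prod_(y : G) g y != 0 by apply/prodf_neq0 => y _; exact: character_neq0.
apply: (mulIf nz); rewrite mul1r [RHS](reindex_inj (addrI x)).
under [RHS]eq_bigr => y _ do rewrite characterD.
by rewrite big_split /= prodr_const.
Qed.

(* Character values are #|G|-th roots of unity, hence finitely many: this makes
   [character] a finite type, namely the dual group of G. *)
Definition unity_roots : seq R[i] :=
  sval (closed_field_poly_normal ('X^#|G| - 1 : {poly R[i]})).

Lemma mem_unity_roots (g : character) x : g x \in unity_roots.
Proof.
have G0 : (0 < #|G|)%N by apply/card_gt0P; exists 0.
rewrite /unity_roots; case: closed_field_poly_normal => s /= Hs.
have lc : lead_coef ('X^#|G| - 1 : {poly R[i]}) = 1.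
  by rewrite -polyC1 lead_coefXnsubC.
rewrite lc scale1r in Hs.
rewrite -root_prod_XsubC -Hs.
by rewrite rootE !hornerE character_unity subrr.
Qed.

Definition char_code (g : character) : {ffun G -> 'I_(size unity_roots).+1} :=
  [ffun x => inord (index (g x) unity_roots)].

Definition char_decode (c : {ffun G -> 'I_(size unity_roots).+1}) :
  option character := insub [ffun x => unity_roots`_(c x)].

Lemma char_codeK : pcancel char_code char_decode.
Proof.
move=> g; rewrite /char_decode.
have -> : [ffun x => unity_roots`_(char_code g x)] = char_ffun g.
  apply/ffunP => x; rewrite !ffunE inordK ?ltnS ?index_size //.
  by rewrite nth_index ?mem_unity_roots.
exact: valK.
Qed.

HB.instance Definition _ := PCanIsCountable char_codeK.
HB.instance Definition _ :=
  fintype.isFinite.Build character (pcan_enumP char_codeK).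

Fact trivial_character_subproof : is_character [ffun=> 1].
Proof.
apply/andP; split; apply/forallP => x.
  by apply/forallP => y; rewrite !ffunE mulr1.
by rewrite ffunE ComplexField.Normc.normc1.
Qed.

Definition trivial_character : character :=
  Character trivial_character_subproof.

Definition fourier (f : G -> R[i]) (g : character) : R[i] :=
  \sum_(x : G) f x * conjc (g x).

Definition dual_average (F : character -> R) : R :=
  (\sum_(g : character) F g) / #|{: character}|%:R.

Definition l2norm (f : G -> R[i]) : R :=
  Num.sqrt (\sum_(x : G) normc (f x) ^+ 2).

(* The maximum over nontrivial characters; it is 0 if there are none. *)
Definition max_nontrivial_sum (Phi : {set G}) : R :=
  \big[Num.max/0]_(g : character | g != trivial_character)
    normc (\sum_(x in Phi) g x).

End Characters.

(* Main.v *)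
(* Restriction estimate by the Tomas-Stein method.  Put L = ||f||_2^2,
   n = |Phi|, p = q/2 and y(g) = |fourier f g|^2.

   If y >= s on a set B of characters, then pairing fourier f with phases on B
   and applying Cauchy-Schwarz on Phi gives
   |B|^2 s <= L (|B| n + |B|^2 eps n), because distinct characters are almost
   orthogonal on Phi.  Hence |B| s <= 2 n L as soon as s >= 2 eps n L: above the
   threshold 2 eps n L, the k-th largest value of y is at most 2 n L / k, and
   summing its p-th power over k gives the 1/|G| term.  Below the threshold,
   y^p <= (2 eps n L)^(p-1) y and Parseval give the eps^(p-1)/|Phi| term. *)
Require Import Defs.
From mathcomp Require Import all_boot all_order all_algebra.
From mathcomp Require Import complex.
From mathcomp Require Import all_classical all_reals all_analysis.
From mathcomp Require Import separable cyclotomic ring lra.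

Set Implicit Arguments.
Unset Strict Implicit.
Unset Printing Implicit Defensive.

Import Order.TTheory GRing.Theory Num.Theory.
Local Open Scope ring_scope.

(** * Separation of points by characters, through simultaneous diagonalization *)

(** [X^N - 1] splits over the closed field [R[i]], with simple roots in characteristic zero, and the
    minimal polynomial of [A] divides it. *)
Lemma diagonalizable_unity (R : realType) n (A : 'M[R[i]]_n.+1) N :
  (0 < N)%N -> A ^+ N = 1 -> diagonalizable A.
Proof.
move=> N0 AN; apply/diagonalizableP.
have [s Hs] := closed_field_poly_normal ('X^N - 1 : {poly R[i]}).
rewrite -polyC1 lead_coefXnsubC // scale1r in Hs.
exists s.
  rewrite -separable_prod_XsubC -Hs polyC1 separable_Xn_sub_1 //.
  by rewrite pnatr_eq0 -lt0n.
rewrite -Hs; apply: mxminpoly_min.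
by rewrite rmorphB rmorphXn /= horner_mx_X horner_mx_C AN subrr.
Qed.

Lemma normc_unity (R : rcfType) (z : R[i]) N :
  (0 < N)%N -> z ^+ N = 1 -> normc z = 1.
Proof.
move=> N0 zN.
have z0 : 0 <= normc z by case: (z) => a b; exact: sqrtr_ge0.
apply/eqP; rewrite -(pexpr_eq1 N0 z0) // ; apply/eqP.
rewrite -[RHS](@ComplexField.Normc.normc1 R) -[in RHS]zN.
elim: N {N0 zN} => [|k IH]; first by rewrite !expr0 ComplexField.Normc.normc1.
by rewrite !exprS ComplexField.Normc.normcM IH.
Qed.

(* The diagonal entries of the simultaneously diagonalized [A y] are characters
   of [y]. *)
Lemma exists_character (R : realType) (G : finZmodType) (n : nat)
    (A : G -> 'M[R[i]]_n.+1) (x : G) :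
  A 0 = 1 -> {morph A : u v / u + v >-> u * v} -> A x != 1 ->
  exists g : character R G, g x != 1.
Proof.
move=> A0 AD Ax.
have G0 : (0 < #|G|)%N by apply/card_gt0P; exists 0.
have AX y k : A y ^+ k = A (y *+ k).
  by elim: k => [|k IH]; rewrite ?A0 // exprS IH mulrS AD.
have AN y : A y ^+ #|G| = 1.
  rewrite AX; suff -> : y *+ #|G| = 0 by [].
  (* Translation by [y] permutes [G], so the sum of all elements absorbs [#|G|] copies of [y]. *)
  apply: (addIr (\sum_(u : G) u)); rewrite add0r [RHS](reindex_inj (addrI y)).
  by rewrite big_split /= sumr_const.
have : codiagonalizable [seq A y | y <- enum G].
  apply/codiagonalizableP; split.
    move=> _ _ /mapP[u _ ->] /mapP[v _ ->].
    by rewrite /comm_mx !mulmxE -!AD addrC.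
  by move=> _ /mapP[u _ ->]; exact: (diagonalizable_unity G0 (AN u)).
case=> P Pu /allP PA.
have D y : exists d, P *m A y = diag_mx d *m P.
  have /PA/diagonalizable_forPex[d] : A y \in [seq A y | y <- enum G].
    by apply/mapP; exists y; rewrite ?mem_enum.
  by move=> /(simmxP Pu) dy; exists d.
have {}D y : exists d : 'rV_n.+1, A y = invmx P *m diag_mx d *m P.
  by have [d dE] := D y; exists d; rewrite -mulmxA -dE mulKmx.
have {D} [d dE] := choice D.
have dV y : diag_mx (d y) = P *m A y *m invmx P.
  by rewrite dE !mulmxA mulmxV // mul1mx mulmxK.
have d0 i : d 0 0 i = 1.
  have /matrixP/(_ i i) := dV 0.
  by rewrite A0 mulmx1 mulmxV // !mxE eqxx.
(* The basis [P] is the same for all [y], so multiplicativity of [A] passes to each diagonal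
   entry. *)
have dD i u v : d (u + v) 0 i = d u 0 i * d v 0 i.
  have : diag_mx (d (u + v)) = diag_mx (d u) *m diag_mx (d v).
    by rewrite !dV AD !mulmxA mulmxKV.
  by rewrite mulmx_diag => /matrixP/(_ i i); rewrite !mxE eqxx !mulr1n.
have dN i y : normc (d y 0 i) = 1.
  apply: (@normc_unity _ _ #|G|) => //.
  have dX k : d y 0 i ^+ k = d (y *+ k) 0 i.
    by elim: k => [|k IH]; rewrite ?d0 // exprS IH mulrS dD.
  have /matrixP/(_ i i) := dV (y *+ #|G|).
  by rewrite -AX AN mulmx1 mulmxV // !mxE eqxx !mulr1n dX.
pose gf i := [ffun y => d y 0 i].
have gP i : is_character (gf i).
  apply/andP; split; apply/forallP => u; last by rewrite ffunE dN.
  by apply/forallP => v; rewrite !ffunE dD.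
case: (boolP [exists i, d x 0 i != 1]) => [/existsP[i di]|].
  by exists (Character (gP i)); rewrite /= ffunE.
(* If every diagonal entry at [x] were 1, [A x] would be conjugate to the identity, hence equal to
   it. *)
move=> /existsPn di; case/eqP: Ax.
rewrite dE; suff -> : diag_mx (d x) = 1 by rewrite mulmx1 mulVmx.
by apply/matrixP => i j; rewrite !mxE (eqP (negPn (di i))).
Qed.

(* Applied to the regular representation. *)
Lemma character_separates (R : realType) (G : finZmodType) (x : G) :
  x != 0 -> exists g : character R G, g x != 1.
Proof.
move=> x0.
have [n nE] : exists n, #|G| = n.+1.
  by exists #|G|.-1; rewrite prednK //; apply/card_gt0P; exists 0.
pose e (i : 'I_n.+1) : G := enum_val (cast_ord (esym nE) i).
pose r (y : G) : 'I_n.+1 := cast_ord nE (enum_rank y).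
have er : cancel r e by move=> y; rewrite /e /r cast_ordK enum_rankK.
have re : cancel e r by move=> i; rewrite /e /r enum_valK cast_ordKV.
(* The permutation matrix of translation by [y]. *)
pose A (y : G) : 'M[R[i]]_n.+1 := \matrix_(i, j) (e i + y == e j)%:R.
apply: (@exists_character _ _ _ A).
- by apply/matrixP => i j; rewrite !mxE addr0 (can_eq re).
- move=> u v; apply/matrixP => i j; rewrite -mulmxE !mxE (bigD1 (r (e i + u))) //=.
  rewrite big1 ?addr0 => [|k ki].
    by rewrite !mxE er eqxx mul1r addrA.
  have /negPf ek : e i + u != e k by apply: contra ki => /eqP ->; rewrite re.
  by rewrite !mxE ek mul0r.
(* In row [r 0] and column [r x], [A x] has entry 1, while the identity has a 1 there only if
   [x = 0]. *)
- apply: contra x0 => /eqP/matrixP/(_ (r 0) (r x)).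
  rewrite !mxE !er add0r eqxx (can_eq er) [0 == x]eq_sym.
  by case: (x == 0) => // /eqP; rewrite oner_eq0.
Qed.

(** * Complex moduli and Cauchy-Schwarz *)

Lemma sqr_normcE (R : rcfType) (z : R[i]) :
  (normc z ^+ 2)%:C%C = z * conjc z.
Proof.
rewrite -sqr_normc normc_def rmorphXn /=.
by case: z.
Qed.

Lemma normc_conjc (R : rcfType) (z : R[i]) : normc (conjc z) = normc z.
Proof. by case: z => a b /=; rewrite sqrrN. Qed.

Lemma normc_ge0 (R : rcfType) (z : R[i]) : 0 <= normc z.
Proof. by case: z => a b; exact: sqrtr_ge0. Qed.

Lemma normc_real (R : rcfType) (a : R) : 0 <= a -> normc a%:C%C = a.
Proof. by move=> a0; rewrite /= expr0n addr0 sqrtr_sqr ger0_norm. Qed.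

Lemma ler_normc_sum (R : rcfType) (I : Type) (r : seq I) (P : pred I)
    (F : I -> R[i]) :
  normc (\sum_(i <- r | P i) F i) <= \sum_(i <- r | P i) normc (F i).
Proof.
elim/big_rec2: _ => [|i y z _ IH]; first by rewrite ComplexField.Normc.normc0.
by apply: le_trans (le_normcD _ _) _; rewrite lerD2l.
Qed.

(** The witness is the conjugate of [z] over its modulus, or 0 when [z = 0]; hence a bound on
    [normc c] and not an equality. *)
Lemma normc_phase (R : rcfType) (z : R[i]) :
  exists2 c : R[i], normc c <= 1 & c * z = (normc z)%:C%C.
Proof.
have [->|z0] := eqVneq z 0.
  exists 0; first by rewrite ComplexField.Normc.normc0 ler01.
  by rewrite mul0r ComplexField.Normc.normc0.
have nz : normc z != 0.
  by apply: contra z0 => /eqP/ComplexField.Normc.eq0_normc ->.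
exists (conjc z * ((normc z)^-1)%:C%C).
  rewrite ComplexField.Normc.normcM normc_conjc normc_real ?invr_ge0 ?normc_ge0 //.
  by rewrite divff.
by rewrite mulrAC [conjc z * z]mulrC -sqr_normcE -rmorphM /= expr2 mulfK.
Qed.

(** Lagrange's identity: twice the difference of the two sides is a sum of squares over ordered
    pairs. *)
Lemma cauchy_schwarz_sum (R : realFieldType) (I : finType) (A : {set I})
    (a b : I -> R) :
  (\sum_(i in A) a i * b i) ^+ 2
    <= (\sum_(i in A) a i ^+ 2) * (\sum_(i in A) b i ^+ 2).
Proof.
rewrite -subr_ge0 -(pmulr_rge0 _ (ltr0n R 2)).
have -> : 2 * ((\sum_(i in A) a i ^+ 2) * (\sum_(i in A) b i ^+ 2)
    - (\sum_(i in A) a i * b i) ^+ 2)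
  = \sum_(i in A) \sum_(j in A) (a i * b j - a j * b i) ^+ 2.
  have E (u v : I -> R) : \sum_(i in A) \sum_(j in A) u i * v j
      = (\sum_(i in A) u i) * (\sum_(j in A) v j).
    by rewrite big_distrl /=; apply: eq_bigr => i _; rewrite big_distrr.
  transitivity (\sum_(i in A) (\sum_(j in A) a i ^+ 2 * b j ^+ 2
      + \sum_(j in A) b i ^+ 2 * a j ^+ 2
      - 2 * \sum_(j in A) (a i * b i) * (a j * b j))).
    by rewrite sumrB big_split /= -mulr_sumr !E; ring.
  apply: eq_bigr => i _; rewrite mulr_sumr -big_split -sumrB /=.
  by apply: eq_bigr => j _; ring.
by do 2 (apply: sumr_ge0 => ? _); exact: sqr_ge0.
Qed.

(** * The dual group: orthogonality, cardinality and Parseval *)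

Section DualGroup.
Variables (R : realType) (G : finZmodType).
Implicit Types (g h : character R G) (f : G -> R[i]).

Lemma conjc_characterM g x : conjc (g x) * g x = 1.
Proof. by rewrite mulrC -sqr_normcE normc_character expr1n. Qed.

Lemma character0 g : g 0 = 1.
Proof.
by apply: (mulfI (character_neq0 g 0)); rewrite -characterD addr0 mulr1.
Qed.

Lemma characterN g x : g (- x) = conjc (g x).
Proof.
apply: (mulIf (character_neq0 g x)).
by rewrite conjc_characterM -characterD addNr character0.
Qed.

Fact character_mul_subproof g h : is_character [ffun x => g x * h x].
Proof.
apply/andP; split; apply/forallP => x.
  by apply/forallP => y; rewrite !ffunE !characterD mulrACA.
by rewrite ffunE ComplexField.Normc.normcM !normc_character mulr1.
Qed.

Definition character_mul g h := Character (character_mul_subproof g h).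

Fact character_conj_subproof g : is_character [ffun x => conjc (g x)].
Proof.
apply/andP; split; apply/forallP => x.
  by apply/forallP => y; rewrite !ffunE !characterD rmorphM.
by rewrite ffunE normc_conjc normc_character.
Qed.

Definition character_conj g := Character (character_conj_subproof g).

Lemma characterP g h : (forall x, g x = h x) -> g = h.
Proof. by move=> gh; apply/val_inj/ffunP. Qed.

Lemma character_mulI g : injective (character_mul g).
Proof.
move=> h k E; apply: characterP => x; apply: (mulfI (character_neq0 g x)).
by have /ffunP/(_ x) := congr1 val E; rewrite !ffunE.
Qed.

(** Multiplication by a character [h] with [h x != 1] permutes the dual, so the sum is fixed by the
    factor [h x]. *)
Lemma sum_dual x : x != 0 -> \sum_(g : character R G) g x = 0.
Proof.
move=> /(character_separates R)[h hx].
suff: (h x - 1) * (\sum_(g : character R G) g x) = 0.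
  by move/eqP; rewrite mulf_eq0 subr_eq0 (negPf hx) => /eqP.
rewrite mulrBl mul1r [X in _ - X](reindex_inj (@character_mulI h)) /=.
rewrite big_distrr /= -sumrB big1 // => g _.
by rewrite ffunE subrr.
Qed.

Lemma sum_character g : g != trivial_character R G -> \sum_(x : G) g x = 0.
Proof.
move=> gn1.
have [y gy] : exists y, g y != 1.
  apply/existsP; apply: contraR gn1 => /existsPn gE.
  by apply/eqP/characterP => x; rewrite ffunE; apply/eqP/negPn.
suff: (g y - 1) * (\sum_(x : G) g x) = 0.
  by move/eqP; rewrite mulf_eq0 subr_eq0 (negPf gy) => /eqP.
rewrite mulrBl mul1r [X in _ - X](reindex_inj (addrI y)) /=.
rewrite big_distrr /= -sumrB big1 // => x _.
by rewrite characterD subrr.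
Qed.

(** Double counting of the sum of [g x] over all pairs: by orthogonality only [x = 0] survives in
    one order, only the trivial character in the other. *)
Lemma card_character : #|{: character R G}| = #|G|.
Proof.
apply/eqP; rewrite -(eqr_nat R[i]); apply/eqP.
transitivity (\sum_(x : G) \sum_(g : character R G) g x).
  rewrite (bigD1 0) //= [X in _ + X]big1 => [|x]; last exact: sum_dual.
  under eq_bigr do rewrite character0.
  by rewrite addr0 sumr_const.
rewrite exchange_big /= (bigD1 (trivial_character R G)) //=.
rewrite [X in _ + X]big1 => [|g]; last exact: sum_character.
under eq_bigr do rewrite ffunE.
by rewrite addr0 sumr_const.
Qed.

(** After expanding the square, the sum over [g] of [g (y - x)] removes every off-diagonal pair and
    contributes [#|G|] on the diagonal. *)
Lemma parseval f :
  \sum_(g : character R G) normc (fourier f g) ^+ 2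
    = #|G|%:R * \sum_(x : G) normc (f x) ^+ 2.
Proof.
apply: (@complexI R); rewrite rmorphM rmorph_nat !rmorph_sum /=.
under eq_bigr do rewrite sqr_normcE /fourier rmorph_sum /= big_distrl /=.
under [X in _ = _ * X]eq_bigr do rewrite sqr_normcE.
rewrite exchange_big big_distrr /=; apply: eq_bigr => x _.
under eq_bigr do rewrite big_distrr /=.
rewrite exchange_big (bigD1 x) //= [X in _ + X]big1 ?addr0 => [|y yx].
  transitivity (\sum_(g : character R G) f x * conjc (f x)).
    apply: eq_bigr => g _; rewrite rmorphM /= conjcK.
    by rewrite mulrACA conjc_characterM mulr1.
  by rewrite sumr_const card_character mulr_natl.
transitivity (f x * conjc (f y) * \sum_(g : character R G) g (y - x)).
  rewrite big_distrr /=; apply: eq_bigr => g _.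
  by rewrite rmorphM /= conjcK characterD characterN mulrACA [conjc _ * _]mulrC.
by rewrite sum_dual ?mulr0 // subr_eq0.
Qed.

End DualGroup.

(** * Large sieve for characters restricted to [Phi] *)

Section LargeSieve.
Variables (R : realType) (G : finZmodType) (eps : R) (Phi : {set G}).
Hypothesis eps0 : 0 <= eps.
Hypothesis Phi_eps : max_nontrivial_sum R Phi <= eps * #|Phi|%:R.

(** The product of [h] with the conjugate of [g] is a character, nontrivial unless [g = h]. Allowing
    the [eps] term on the diagonal too keeps the bound easy to sum over all pairs. *)
Lemma character_correlation (g h : character R G) :
  normc (\sum_(x in Phi) conjc (g x) * h x)
    <= (g == h)%:R * #|Phi|%:R + eps * #|Phi|%:R.
Proof.
have [<-|gh] := eqVneq g h.
  under eq_bigr do rewrite conjc_characterM.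
  rewrite sumr_const mul1r -(rmorph_nat (real_complex R)) normc_real ?ler0n //.
  by rewrite lerDl mulr_ge0.
rewrite mul0r add0r; apply: le_trans Phi_eps.
pose k := character_mul (character_conj g) h.
have kn1 : k != trivial_character R G.
  apply: contra gh => /eqP kE; apply/eqP/characterP => x.
  have /ffunP/(_ x) := congr1 val kE; rewrite !ffunE => ghx.
  apply: (mulfI (character_neq0 (character_conj g) x)).
  by rewrite !ffunE conjc_characterM ghx.
have -> : \sum_(x in Phi) conjc (g x) * h x = \sum_(x in Phi) k x.
  by apply: eq_bigr => x _; rewrite !ffunE.
exact: (le_bigmax_cond _ (fun g : character R G => normc (\sum_(x in Phi) g x))).
Qed.

(* Duality: pair [fourier f] with unimodular phases [c g], and expand the
   resulting dual sum [h] over pairs of characters. *)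
Lemma large_sieve (f : G -> R[i]) (B : {set character R G}) :
  [set x | f x != 0] \subset Phi ->
  (\sum_(g in B) normc (fourier f g)) ^+ 2
    <= (\sum_(x : G) normc (f x) ^+ 2)
       * (#|B|%:R * #|Phi|%:R + #|B|%:R ^+ 2 * (eps * #|Phi|%:R)).
Proof.
move=> fPhi.
have [c c1 cE] : exists2 c : character R G -> R[i], forall g, normc (c g) <= 1
    & forall g, c g * fourier f g = (normc (fourier f g))%:C%C.
  have /choice[c cP] : forall g : character R G, exists z : R[i],
      normc z <= 1 /\ z * fourier f g = (normc (fourier f g))%:C%C.
    by move=> g; have [z ? ?] := normc_phase (fourier f g); exists z.
  by exists c => g; case: (cP g).
pose h x := \sum_(g in B) c g * conjc (g x).
have f0 x : x \notin Phi -> f x = 0.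
  move=> xPhi; apply/eqP; apply: contraR xPhi => fx.
  by apply: (fintype.subsetP fPhi); rewrite inE.
have supp : \sum_(x in Phi) normc (f x) ^+ 2 = \sum_(x : G) normc (f x) ^+ 2.
  rewrite [RHS](bigID (mem Phi)) /= [X in _ + X]big1 ?addr0 // => x xPhi.
  by rewrite f0 // ComplexField.Normc.normc0 expr0n.
have S_le : \sum_(g in B) normc (fourier f g)
    <= \sum_(x in Phi) normc (f x) * normc (h x).
  have -> : \sum_(g in B) normc (fourier f g)
      = normc (\sum_(x in Phi) f x * h x).
    rewrite -[LHS]normc_real ?sumr_ge0 // => [|g _]; last exact: normc_ge0.
    congr (normc _); rewrite rmorph_sum /=.
    under eq_bigr do rewrite -cE /fourier big_distrr /=.
    rewrite exchange_big (bigID (mem Phi)) /=.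
    rewrite [X in _ + X]big1 ?addr0 => [|x xPhi]; last first.
      by rewrite big1 // => g _; rewrite f0 // mul0r mulr0.
    apply: eq_bigr => x _; rewrite big_distrr /=.
    by apply: eq_bigr => g _; rewrite mulrCA.
  apply: le_trans (ler_normc_sum _ _ _) _.
  by under eq_bigr do rewrite ComplexField.Normc.normcM.
have S0 : 0 <= \sum_(g in B) normc (fourier f g).
  by apply: sumr_ge0 => g _; exact: normc_ge0.
apply: le_trans (_ : (\sum_(x in Phi) normc (f x) * normc (h x)) ^+ 2 <= _).
  by rewrite lerXn2r ?nnegrE //; exact: le_trans S_le.
apply: le_trans (cauchy_schwarz_sum _ _ _) _.
rewrite supp; apply: ler_wpM2l.
  by apply: sumr_ge0 => x _; exact: sqr_ge0.
(* This nonnegative sum is written as a modulus so that the triangle inequality applies to its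
   expansion over pairs. *)
have -> : \sum_(x in Phi) normc (h x) ^+ 2
  = normc (\sum_(g in B) \sum_(k in B)
      c g * conjc (c k) * \sum_(x in Phi) conjc (g x) * k x).
  rewrite -[LHS]normc_real ?sumr_ge0 // => [|x _]; last exact: sqr_ge0.
  congr (normc _); rewrite rmorph_sum /=.
  under eq_bigr do rewrite sqr_normcE /h rmorph_sum /= big_distrl /=.
  rewrite exchange_big; apply: eq_bigr => g _.
  under eq_bigr do rewrite big_distrr /=.
  rewrite exchange_big; apply: eq_bigr => k _.
  rewrite big_distrr; apply: eq_bigr => x _.
  by rewrite rmorphM /= conjcK mulrACA.
apply: le_trans (ler_normc_sum _ _ _) _.
have -> : #|B|%:R * #|Phi|%:R + #|B|%:R ^+ 2 * (eps * #|Phi|%:R)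
  = \sum_(g in B) \sum_(k in B)
      ((g == k)%:R * #|Phi|%:R + eps * #|Phi|%:R) :> R.
  under [RHS]eq_bigr => g gB.
    rewrite big_split /= sumr_const (bigD1 g) //= eqxx mul1r.
    rewrite big1 ?addr0; last first.
      by move=> k /andP[_]; rewrite eq_sym => /negPf ->; rewrite mul0r.
    over.
  by rewrite sumr_const -[eps * _ *+ _]mulr_natl -[RHS]mulr_natl; ring.
apply: ler_sum => g _; apply: le_trans (ler_normc_sum _ _ _) _.
apply: ler_sum => k _; apply: le_trans (character_correlation g k).
rewrite !ComplexField.Normc.normcM normc_conjc ler_piMl ?normc_ge0 //.
by rewrite mulr_ile1 ?normc_ge0.
Qed.

(** A weak-type bound, obtained from the large sieve by absorbing its [eps] term into the left
    side. *)
Lemma card_large_spectrum (f : G -> R[i]) (B : {set character R G}) (s : R) :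
  [set x | f x != 0] \subset Phi ->
  2 * eps * #|Phi|%:R * (\sum_(x : G) normc (f x) ^+ 2) <= s ->
  (forall g, g \in B -> s <= normc (fourier f g) ^+ 2) ->
  #|B|%:R * s <= 2 * #|Phi|%:R * (\sum_(x : G) normc (f x) ^+ 2).
Proof.
move=> fPhi; set L := \sum_(x : G) _ => s_ge sB.
have L0 : 0 <= L by apply: sumr_ge0 => x _; exact: sqr_ge0.
have n0 : 0 <= #|Phi|%:R :> R by [].
have s0 : 0 <= s by apply: le_trans s_ge; rewrite !mulr_ge0.
have [->|B_gt0] := posnP #|B|; first by rewrite mul0r !mulr_ge0.
have b0 : 0 < #|B|%:R :> R by rewrite ltr0n.
have S : (#|B|%:R * Num.sqrt s) ^+ 2 <=
    (\sum_(g in B) normc (fourier f g)) ^+ 2.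
  rewrite lerXn2r ?nnegrE ?mulr_ge0 ?sqrtr_ge0 ?sumr_ge0 //.
    by move=> g _; exact: normc_ge0.
  rewrite mulr_natl -sumr_const; apply: ler_sum => g gB.
  by rewrite -(ler_sqr (sqrtr_ge0 _) (normc_ge0 _)) sqr_sqrtr // sB.
move: (le_trans S (large_sieve B fPhi)).
rewrite exprMn sqr_sqrtr // -/L => {}S.
rewrite -(ler_pM2l b0).
(* By the lower bound on [s], the [eps] term is at most half of [#|B|^2 s]. *)
have : #|B|%:R ^+ 2 * (2 * eps * #|Phi|%:R * L) <= #|B|%:R ^+ 2 * s.
  by apply: ler_wpM2l => //; exact: sqr_ge0.
nra.
Qed.

End LargeSieve.

(** * Real-variable bounds: sums of [p]-th powers from a weak-type bound *)

(** The power is [exp (- a ln (1 - w))]; then [- ln (1 - w) >= w] and [exp t >= 1 + t]. *)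
Lemma bernoulli_powR (R : realType) (a w : R) : 0 <= a -> 0 <= w < 1 ->
  1 + a * w <= ((1 - w)^-1) `^ a.
Proof.
move=> a0 /andP[w0 w1].
have w1' : 0 < (1 - w)^-1 by rewrite invr_gt0 subr_gt0.
rewrite /powR gt_eqF //; apply: le_trans (expR_ge1Dx _); rewrite lerD2l.
apply: ler_wpM2l => //; rewrite lnV ?posrE ?subr_gt0 // lerNr.
by apply: le_ln1Dx; rewrite ltrN2.
Qed.

(* Telescoping: [(m+1)^-p <= (m^(1-p) - (m+1)^(1-p)) / (p-1)]. *)
Lemma sum_powR_inv_le (R : realType) (p : R) (m : nat) : 1 < p ->
  \sum_(k < m) (k.+1%:R^-1) `^ p <= 1 + (p - 1)^-1.
Proof.
move=> p1; have a0 : 0 < p - 1 by rewrite subr_gt0.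
case: m => [|m]; first by rewrite big_ord0 addr_ge0 // invr_ge0 ltW.
(* The induction needs the telescoped remainder, which the final bound drops. *)
suff: \sum_(k < m.+1) (k.+1%:R^-1) `^ p
    <= 1 + (p - 1)^-1 * (1 - (m.+1%:R^-1) `^ (p - 1)).
  move/le_trans; apply.
  by rewrite lerD2l ler_piMr ?gerBl ?powR_ge0 // invr_ge0 ltW.
elim: m => [|m IH].
  by rewrite big_ord1 invr1 !powR1 subrr mulr0 addr0.
rewrite big_ord_recr /=; apply: le_trans (lerD IH (lexx _)) _.
rewrite -addrA lerD2l -lerBrDl -mulrBr -(ler_pM2l a0) mulrA divff ?gt_eqF //.
rewrite mul1r.
set w : R := m.+2%:R^-1.
have m1 : 0 < m.+1%:R :> R by rewrite ltr0n.
have m2 : 0 < m.+2%:R :> R by rewrite ltr0n.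
have w0 : 0 < w by rewrite invr_gt0.
have w1 : w < 1 by rewrite invf_lt1 // ltr1n.
(* After this substitution, [w ^ (p - 1)] factors out and what remains is the Bernoulli bound with
   exponent [p - 1]. *)
have -> : m.+1%:R^-1 = w * (1 - w)^-1.
  rewrite /w -[m.+2%:R]natr1; move: m1; set u : R := m.+1%:R => u0.
  by field; rewrite addrK !gt_eqF // addr_gt0.
rewrite powRM ?invr_ge0 ?subr_ge0 ?(ltW w0) ?(ltW w1) //.
rewrite -(@mulr_powRB1 _ w p) ?(ltW w0) ?(lt_trans _ p1) //.
have := @bernoulli_powR _ (p - 1) w (ltW a0).
rewrite ltW //= => /(_ w1) /(ler_wpM2l (powR_ge0 w (p - 1))).
rewrite mulrDr mulr1. nra.
Qed.

(* The k-th largest value of [y] is at most [K / k]; peel off the smallest. *)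
Lemma sum_powR_weak_le (R : realType) (I : finType) (p K : R) (A : {set I})
    (y : I -> R) :
  0 <= p -> 0 <= K -> (forall i, 0 <= y i) ->
  (forall (B : {set I}) s, B \subset A -> (forall i, i \in B -> s <= y i) ->
     #|B|%:R * s <= K) ->
  \sum_(i in A) y i `^ p <= K `^ p * \sum_(k < #|A|) (k.+1%:R^-1) `^ p.
Proof.
move=> p0 K0 y0; move mE : #|A| => m.
elim: m A mE => [|m IH] A mE weak.
  by rewrite big_ord0 mulr0 (cards0_eq mE) big_set0.
have /card_gt0P[i0 i0A] : (0 < #|A|)%N by rewrite mE.
case: (@Order.TotalTheory.arg_minP _ _ _ i0 (mem A) y i0A) => i /= iA imin.
have {}iA : i \in A by [].
have cA : #|A :\ i| = m by move: mE; rewrite (cardsD1 i) iA add1n => -[].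
rewrite (bigD1 i) //= big_ord_recr /= mulrDr addrC; apply: lerD.
  rewrite (eq_bigl (mem (A :\ i))) => [|j]; last by rewrite !inE andbC.
  apply: IH => // B s BA; apply: weak.
  exact: fintype.subset_trans BA (subD1set _ _).
(* The minimum is at most [K / (m + 1)], by the weak bound with [B = A] and [s = y i]; this pays for
   the last term of the sum. *)
rewrite -powRM ?invr_ge0 //; apply: ge0_ler_powR; rewrite ?nnegrE ?divr_ge0 //.
by rewrite ler_pdivlMr ?ltr0n // mulrC -mE; apply: weak.
Qed.

(** * The restriction estimate *)

Section Restriction.
Variables (R : realType) (q : R).
Hypothesis q2 : 2 < q.

Local Notation p := (q / 2).

Lemma half_gt1 : 1 < p.
Proof. by rewrite ltr_pdivlMr // mul1r. Qed.

(** The factor [2 ^ p] comes from [K = 2 n L], and [(p - 1)^-1] from the sum of [k ^ (- p)]; the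
    product also dominates the [2 ^ (p - 1)] of the threshold. *)
Definition restriction_const : R := 2 `^ p * (2 + (p - 1)^-1).

Lemma restriction_const_ge0 : 0 <= restriction_const.
Proof.
rewrite mulr_ge0 ?powR_ge0 // addr_ge0 // invr_ge0.
by rewrite subr_ge0 ltW // half_gt1.
Qed.

Lemma powR_half (x : R) : 0 <= x -> x `^ q = (x ^+ 2) `^ p.
Proof.
by move=> x0; rewrite -powR_mulrn // -powRrM mulrC divfK // pnatr_eq0.
Qed.

Lemma restriction_estimate (G : finZmodType) (eps : R) (Phi : {set G})
    (f : G -> R[i]) :
  0 <= eps -> max_nontrivial_sum R Phi <= eps * #|Phi|%:R ->
  [set x | f x != 0] \subset Phi ->
  dual_average (fun g => normc (fourier f g) `^ q)
    <= restriction_const * l2norm f `^ q * #|Phi|%:R `^ p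
       * (#|G|%:R^-1 + eps `^ (p - 1) * #|Phi|%:R^-1).
Proof.
move=> eps0 Phi_eps fPhi.
have p1 := half_gt1.
have p0 : 0 < p by apply: lt_trans p1.
have p10 : 0 < p - 1 by rewrite subr_gt0.
set n : R := #|Phi|%:R; set N : R := #|G|%:R.
have n0 : 0 <= n by [].
have N0 : 0 < N by rewrite ltr0n; apply/card_gt0P; exists 0.
set L := \sum_(x : G) normc (f x) ^+ 2.
have L0 : 0 <= L by apply: sumr_ge0 => x _; exact: sqr_ge0.
have -> : l2norm f `^ q = L `^ p.
  by rewrite powR_half ?sqrtr_ge0 // /l2norm sqr_sqrtr.
pose y (g : character R G) := normc (fourier f g) ^+ 2.
have y0 g : 0 <= y g by exact: sqr_ge0.
pose th := 2 * eps * n * L.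
have th0 : 0 <= th by rewrite !mulr_ge0.
pose K := 2 * n * L.
have K0 : 0 <= K by rewrite !mulr_ge0.
rewrite /dual_average card_character -/N.
under eq_bigr do rewrite powR_half ?normc_ge0 // -/(y _).
have large : \sum_(g in [set g | th <= y g]) y g `^ p
    <= K `^ p * (1 + (p - 1)^-1).
  apply: le_trans (sum_powR_weak_le (ltW p0) K0 y0 _) _; last first.
    by rewrite ler_wpM2l ?powR_ge0 // sum_powR_inv_le.
  move=> B s /fintype.subsetP BA sB.
  (* The spectrum bound needs a level of at least [th]. Raising [s] to it keeps a lower bound, since
     [B] lies in the large set. *)
  apply: le_trans (_ : #|B|%:R * Num.max s th <= _).
    by rewrite ler_wpM2l // le_max lexx.
  apply: (card_large_spectrum eps0 Phi_eps fPhi).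
    by rewrite le_max lexx orbT.
  by move=> g gB; rewrite ge_max sB //; have := BA _ gB; rewrite inE.
have small : \sum_(g in ~: [set g | th <= y g]) y g `^ p
    <= N * L * th `^ (p - 1).
  apply: le_trans (_ : \sum_(g : character R G) y g * th `^ (p - 1) <= _).
    rewrite [leRHS](bigID (mem (~: [set g | th <= y g]))) /=.
    rewrite ler_wpDr ?sumr_ge0 // => [g _|]; first by rewrite mulr_ge0 ?powR_ge0.
    apply: ler_sum => g; rewrite !inE -ltNge => /ltW yth.
    rewrite -mulr_powRB1 // ler_wpM2l //.
    by apply: ge0_ler_powR; rewrite ?nnegrE // ltW.
  by rewrite -big_distrl /= parseval.
(* For empty [Phi] both sides vanish, as [p - 1] is positive. *)
have n1 : n `^ (p - 1) = n `^ p * n^-1.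
  rewrite -(@mulr_powRB1 _ n p) //.
  have [->|nn] := eqVneq n 0; first by rewrite powR0 ?gt_eqF // mul0r mul0r.
  by rewrite mulrAC divff // mul1r.
rewrite (bigID (mem [set g | th <= y g])) /= ler_pdivrMr //.
apply: le_trans (lerD large _) _.
  rewrite (eq_bigl (mem (~: [set g | th <= y g]))) => [|g]; last by rewrite !inE.
  exact: small.
rewrite /K /th !powRM ?mulr_ge0 // n1.
rewrite -(@mulr_powRB1 _ L p) //.
set X := L * L `^ (p - 1); set Y := n `^ p; set E := eps `^ (p - 1).
set n' := n^-1; have n'0 : 0 <= n' by rewrite invr_ge0.
have two : 2 `^ (p - 1) <= 2 `^ p :> R by rewrite ler_powR ?ler1n // lerBlDr lerDl.
have P0 : 0 <= 2 `^ p :> R by exact: powR_ge0.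
have X0 : 0 <= X by rewrite mulr_ge0 ?powR_ge0.
have Y0 : 0 <= Y by exact: powR_ge0.
have E0 : 0 <= E by exact: powR_ge0.
rewrite /restriction_const.
set Z := (p - 1)^-1; have Z0 : 0 <= Z by rewrite invr_ge0 ltW.
have -> : 2 `^ p * (2 + Z) * X * Y * (N^-1 + E * n') * N
  = 2 `^ p * (2 + Z) * X * Y + 2 `^ p * (2 + Z) * (X * Y * E * n' * N).
  by field; rewrite ?gt_eqF.
set W := X * Y * E * n' * N.
have W0 : 0 <= W by rewrite !mulr_ge0 ?powR_ge0.
(* [W] is the [eps] term of the target times [N], with [X] standing for [L ^ p]. *)
have -> : N * L * (2 `^ (p - 1) * E * (Y * n') * L `^ (p - 1))
  = 2 `^ (p - 1) * W.
  by rewrite /W /X; ring.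
apply: lerD.
  have -> : 2 `^ p * (2 + Z) * X * Y = 2 `^ p * Y * X * (2 + Z) by ring.
  by rewrite ler_wpM2l ?mulr_ge0 ?powR_ge0 // lerD2r ler1n.
rewrite ler_wpM2r //; apply: le_trans two _; rewrite ler_peMr //.
by rewrite ler_wpDr ?ler1n.
Qed.

End Restriction.

Theorem theorem2p3 (R : realType) (q : R) (hq : 2 < q) :
  exists C : R,
    forall (G : finZmodType) (eps : R) (Phi : {set G}),
      0 <= eps ->
      max_nontrivial_sum R Phi <= eps * #|Phi|%:R ->
      forall f : G -> R[i],
        [set x | f x != 0] \subset Phi ->
        dual_average (fun g => normc (fourier f g) `^ q)
          <= C * l2norm f `^ q * #|Phi|%:R `^ (q / 2)
             * (#|G|%:R^-1 + eps `^ (q / 2 - 1) * #|Phi|%:R^-1)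
        /\ ((forall x, normc (f x) <= 1) ->
            eps <= (#|Phi|%:R / #|G|%:R) `^ (2 / (q - 2)) ->
            dual_average (fun g => normc (fourier f g) `^ q)
              <= C * #|Phi|%:R `^ q * #|G|%:R^-1).
Proof.
(* The factor 2 serves the second claim, where each of the two terms in the bracket is at most
   [#|G|^-1]. *)
exists (2 * restriction_const q) => G eps Phi eps0 Phi_eps f fPhi.
have C0 := restriction_const_ge0 hq.
have main := restriction_estimate hq eps0 Phi_eps fPhi.
move: (restriction_const q) C0 main => c C0 main.
have n0 : 0 <= #|Phi|%:R :> R by [].
have N0 : 0 <= #|G|%:R^-1 :> R by rewrite invr_ge0.
split=> [|f1 eps_le].
  apply: le_trans main _.
  rewrite -!(mulrA 2) ler_peMl ?ler1n // !mulr_ge0 ?powR_ge0 //.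
  by rewrite addr_ge0 // mulr_ge0 ?powR_ge0 ?invr_ge0.
have p1 := half_gt1 hq.
have p0 : 0 < q / 2 by exact: lt_trans p1.
have p10 : 0 < q / 2 - 1 by rewrite subr_gt0.
apply: le_trans main _.
have l2 : l2norm f `^ q <= #|Phi|%:R `^ (q / 2).
  have L0 : 0 <= \sum_(x : G) normc (f x) ^+ 2.
    by apply: sumr_ge0 => x _; exact: sqr_ge0.
  rewrite powR_half ?sqrtr_ge0 // /l2norm sqr_sqrtr //.
  apply: ge0_ler_powR; rewrite ?nnegrE ?(ltW p0) //.
  rewrite (bigID (mem Phi)) /= [X in _ + X]big1 => [|x xPhi]; last first.
    have /eqP -> : f x == 0.
      apply: contraR xPhi => fx.
      by apply: (fintype.subsetP fPhi); rewrite inE.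
    by rewrite ComplexField.Normc.normc0 expr0n.
  rewrite addr0 -sumr_const; apply: ler_sum => x _.
  by rewrite expr_le1 ?normc_ge0.
have eps_n : eps `^ (q / 2 - 1) * #|Phi|%:R^-1 <= #|G|%:R^-1.
  have : eps `^ (q / 2 - 1) <= #|Phi|%:R / #|G|%:R.
    apply: le_trans (ge0_ler_powR (ltW p10) _ _ eps_le) _;
      rewrite ?nnegrE ?powR_ge0 //.
    (* The exponent in the bound on [eps] is the reciprocal of [q / 2 - 1]. *)
    have e1 : 2 / (q - 2) * (q / 2 - 1) = 1 by field; lra.
    by rewrite -powRrM e1 powRr1 // divr_ge0.
  (* For empty [Phi] the convention [0^-1 = 0] makes the [eps] term vanish. *)
  have [->|nn] := eqVneq (#|Phi|%:R : R) 0; first by rewrite invr0 mulr0.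
  by move=> H; rewrite ler_pdivrMr ?lt_def ?nn // [leRHS]mulrC.
(* [#|Phi| ^ q] is split into two factors [Y]: one bounds the norm of [f], the other is already in
   the estimate. *)
rewrite (powR_half q n0) expr2 powRM //.
set Y := _ `^ (q / 2) in l2 *.
have Y0 : 0 <= Y by exact: powR_ge0.
have -> : 2 * c * (Y * Y) * #|G|%:R^-1
  = c * Y * Y * (#|G|%:R^-1 + #|G|%:R^-1) by ring.
apply: ler_pM; rewrite ?mulr_ge0 ?powR_ge0 ?lerD2l //.
- by rewrite addr_ge0 // mulr_ge0 ?powR_ge0 ?invr_ge0.
- by rewrite ler_wpM2r // ler_wpM2l.
Qed.
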